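(* Let $R_x,R_y$ be real with $|R_x|,|R_y|\le1$, and consider the semi-discrete approximation of the physically motivated PML $$\frac{d\mathbf{E}_z}{dt}=-(D_x\otimes I_y)\mathbf{H}_y+(I_x\otimes D_y)\mathbf{H}_x-\boldsymbol{\sigma}\mathbf{E}_z-\alpha_x\left(\tfrac{1-R_x}{2}(P_x^{-1}B_x^+\otimes I_y)\mathbf{E}_z-\tfrac{1+R_x}{2}(P_x^{-1}B_x^-\otimes I_y)\mathbf{H}_y\right)$$ $$\qquad-\alpha_y\left(\tfrac{1-R_y}{2}(I_x\otimes P_y^{-1}B_y^+)\mathbf{E}_z+\tfrac{1+R_y}{2}(I_x\otimes P_y^{-1}B_y^-)\mathbf{H}_x\right),$$ $$\frac{d\mathbf{H}_y}{dt}=-(D_x\otimes I_y)\mathbf{E}_z-\boldsymbol{\sigma}\mathbf{H}_y+\theta_x\left(\tfrac{1-R_x}{2}(P_x^{-1}B_x^-\otimes I_y)\mathbf{E}_z-\tfrac{1+R_x}{2}(P_x^{-1}B_x^+\otimes I_y)\mathbf{H}_y\right),$$ $$\frac{d\mathbf{H}_x}{dt}=(I_x\otimes D_y)\mathbf{E}_z+\boldsymbol{\sigma}(\mathbf{H}_x-\mathbf{P})-\theta_y\left(\tfrac{1-R_y}{2}(I_x\otimes P_y^{-1}B_y^-)\mathbf{E}_z+\tfrac{1+R_y}{2}(I_x\otimes P_y^{-1}B_y^+)\mathbf{H}_x\right),$$ $$\frac{d\mathbf{P}}{dt}=\boldsymbol{\sigma}(\mathbf{H}_x-\mathbf{P}).$$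 Suppose that either (i) $R_x\ne-1$, $R_y\ne-1$, and $\alpha_x=\frac{2}{1+R_x}$, $\alpha_y=\frac{2}{1+R_y}$, $\theta_x=\frac{2\bar\theta_x}{1+R_x}$, $\theta_y=\frac{2\bar\theta_y}{1+R_y}$ with $0\le\bar\theta_x\le\frac{4}{\gamma_x}$, $0\le\bar\theta_y\le\frac{4}{\gamma_y}$; or (ii) $|R_x|\le1$, $|R_y|\le1$, and $\alpha_x=\alpha_y=\theta_x=\theta_y=1$. Then $\mathbf{BT}_s(t)\ge0$, the quantity $$\mathcal{E}^{(2)}_h(t)=\|\mathbf{E}_z(t)\|^2_{\mathbf{P}_{xy}}+\|\mathbf{H}_y(t)\|^2_{\mathbf{P}_{xy}}+\|\mathbf{H}_x(t)\|^2_{\mathbf{P}_{xy}}+\|\mathbf{P}(t)\|^2_{\mathbf{P}_{xy}}+\int_0^t\mathbf{BT}_s(t')\,dt'$$ is an energy (i.e. nonnegative for $t\ge 0$), and the solutions of the discrete problem satisfy $$\frac{d}{dt}\sqrt{\mathcal{E}^{(2)}_h(t)}\le\sigma_\infty\sqrt{\mathcal{E}^{(2)}_h(t)},\qquad\sigma_\infty=\max_x\sigma(x).$$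
   Context: Summation-by-parts (SBP) operators: for $\xi\in\{x,y\}$, $N_\xi\ge2$ is the number of grid points, $I_\xi$ the $N_\xi\times N_\xi$ identity, and $D_\xi=P_\xi^{-1}Q_\xi$ is a real $N_\xi\times N_\xi$ matrix (approximating $\partial/\partial\xi$) with $P_\xi$ diagonal and positive definite and $Q_\xi+Q_\xi^T=E_{R\xi}-E_{L\xi}$, where $E_{L\xi}=\mathrm{diag}(1,0,\dots,0)$, $E_{R\xi}=\mathrm{diag}(0,\dots,0,1)$. Write $B_\xi^{\pm}=E_{R\xi}\pm E_{L\xi}$. $\otimes$ is the Kronecker product, $\mathbf{P}_{xy}=P_x\otimes P_y$ and $\|\mathbf{u}\|^2_{\mathbf{P}_{xy}}=\mathbf{u}^T\mathbf{P}_{xy}\mathbf{u}$. Unknowns $\mathbf{E}_z,\mathbf{H}_y,\mathbf{H}_x,\mathbf{P}$ are functions of $t\ge0$ with values in $\mathbb{R}^{N_xN_y}$. The damping function $\sigma(x)\ge0$ is evaluated at the $x$-grid points $x_i$: $\boldsymbol{\sigma}=\mathrm{diag}(\sigma(x_1),\dots,\sigma(x_{N_x}))\otimes I_y$. For $R_j\ne-1$, $\gamma_j=\frac{1-R_j}{1+R_j}\ge0$ ($j=x,y$); when $\gamma_j=0$ the bound $4/\gamma_j$ is read as $+\infty$. $\mathbf{BT}_s$ denotes the boundary terms produced by the energy method, i.e. for the undamped scheme ($\boldsymbol{\sigma}=0$) $\frac{d}{dt}\left(\|\mathbf{E}_z\|^2_{\mathbf{P}_{xy}}+\|\mathbf{H}_y\|^2_{\mathbf{P}_{xy}}+\|\mathbf{H}_x\|^2_{\mathbf{P}_{xy}}\right)=-\mathbf{BT}_s$;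 explicitly $$\mathbf{BT}_s=\alpha_x(1-R_x)\mathbf{E}_z^T(B_x^+\otimes P_y)\mathbf{E}_z+\left(2-\alpha_x(1+R_x)-\theta_x(1-R_x)\right)\mathbf{E}_z^T(B_x^-\otimes P_y)\mathbf{H}_y+\theta_x(1+R_x)\mathbf{H}_y^T(B_x^+\otimes P_y)\mathbf{H}_y$$ $$\qquad+\alpha_y(1-R_y)\mathbf{E}_z^T(P_x\otimes B_y^+)\mathbf{E}_z-\left(2-\alpha_y(1+R_y)-\theta_y(1-R_y)\right)\mathbf{E}_z^T(P_x\otimes B_y^-)\mathbf{H}_x+\theta_y(1+R_y)\mathbf{H}_x^T(P_x\otimes B_y^+)\mathbf{H}_x.$$ An inequality $\frac{d}{dt}\sqrt{\mathcal{E}}\le\sigma_\infty\sqrt{\mathcal{E}}$ is understood as $\frac{d}{dt}\mathcal{E}\le2\sigma_\infty\mathcal{E}$ (equivalent wherever $\mathcal{E}>0$). *)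

(* Defs.v *)
From HB Require Import structures.
From mathcomp Require Import all_boot all_order all_algebra.
From mathcomp Require Import all_classical all_reals all_analysis.
From mathcomp Require Import mxtens.

Set Implicit Arguments.
Unset Strict Implicit.
Unset Printing Implicit Defensive.

Import Order.TTheory GRing.Theory Num.Theory numFieldNormedType.Exports.

Local Open Scope classical_set_scope.
Local Open Scope ring_scope.

(* u^T W v, as a scalar *)
Definition bilin (R : realType) (n : nat) (W : 'M[R]_n) (u v : 'cV[R]_n) : R :=
  (u^T *m W *m v) 0 0.

Definition sqnorm (R : realType) (n : nat) (W : 'M[R]_n) (u : 'cV[R]_n) : R :=
  bilin W u u.

Definition posdef (R : realType) (n : nat) (W : 'M[R]_n) : Prop :=
  forall u : 'cV[R]_n, u != 0 -> 0 < sqnorm W u.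

Section boundary_matrices.
Context {R : realType} {N : nat}.

Definition EL : 'M[R]_N :=
  \matrix_(i, j) ((i == j) && (i == 0 :> nat))%:R.
Definition ER : 'M[R]_N :=
  \matrix_(i, j) ((i == j) && (i == N.-1 :> nat))%:R.

Definition Bplus : 'M[R]_N := ER + EL.
Definition Bminus : 'M[R]_N := ER - EL.

End boundary_matrices.

Record sbp_op (R : realType) (N : nat) := SbpOp {
  sbpP : 'M[R]_N;
  sbpQ : 'M[R]_N;
  sbpP_diag : is_diag_mx sbpP;
  sbpP_posdef : posdef sbpP;
  sbpQ_byparts : sbpQ + sbpQ^T = ER - EL }.

Definition sbpD (R : realType) (N : nat) (S : sbp_op R N) : 'M[R]_N :=
  invmx (sbpP S) *m sbpQ S.

(* Derivative, relative to the half-line [0, +oo[, at a point t >= 0: one-sided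
   at t = 0 and two-sided for t > 0; values of f on ]-oo, 0[ are irrelevant. *)
Definition is_derive_ge0 (R : realType) (V : normedModType R)
    (f : R -> V) (t : R) (df : V) : Prop :=
  (s - t)^-1 *: (f s - f t) @[s --> within [set s : R | 0 <= s] t^'] --> df.

Definition is_max_of (R : realType) (A : set R) (m : R) : Prop :=
  A m /\ ubound A m.

Record penalties (R : realType) := Penalties {
  alphax : R; alphay : R; thetax : R; thetay : R }.

Definition refl_gamma (R : realType) (r : R) : R := (1 - r) / (1 + r).

(* 0 <= tb <= 4 / gamma, the upper bound being void when gamma = 0 *)
Definition admissible_thetabar (R : realType) (r tb : R) : Prop :=
  0 <= tb /\ (refl_gamma r != 0 -> tb <= 4 / refl_gamma r).

Definition penalties_i (R : realType) (Rx Ry : R) (c : penalties R) : Prop :=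
  [/\ Rx != -1, Ry != -1, alphax c = 2 / (1 + Rx), alphay c = 2 / (1 + Ry) &
    exists tbx tby : R,
      [/\ thetax c = 2 * tbx / (1 + Rx), thetay c = 2 * tby / (1 + Ry),
          admissible_thetabar Rx tbx & admissible_thetabar Ry tby]].

Definition penalties_ii (R : realType) (Rx Ry : R) (c : penalties R) : Prop :=
  [/\ `|Rx| <= 1, `|Ry| <= 1, alphax c = 1, alphay c = 1 &
      thetax c = 1 /\ thetay c = 1].

Section pml.
Context {R : realType} {Nx Ny : nat}.
Implicit Types (Sx : sbp_op R Nx) (Sy : sbp_op R Ny) (c : penalties R).

(* A *t B is the Kronecker product, whose row index is that of A major, that of
   B minor: entry i * Ny + j of a grid vector is its value at (x_i, y_j). *)
Definition Pxy Sx Sy : 'M[R]_(Nx * Ny) := sbpP Sx *t sbpP Sy.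

Definition damping (sigma : R -> R) (xg : 'I_Nx -> R) : 'M[R]_(Nx * Ny) :=
  diag_mx (\row_i sigma (xg i)) *t 1%:M.

Definition pml_solution Sx Sy (sigma : R -> R) (xg : 'I_Nx -> R) (Rx Ry : R) c
    (Ez Hy Hx P : R -> 'cV[R]_(Nx * Ny)) : Prop :=
  let Dx := sbpD Sx *t 1%:M : 'M[R]_(Nx * Ny) in
  let Dy := 1%:M *t sbpD Sy : 'M[R]_(Nx * Ny) in
  let PBxp := (invmx (sbpP Sx) *m Bplus) *t 1%:M : 'M[R]_(Nx * Ny) in
  let PBxm := (invmx (sbpP Sx) *m Bminus) *t 1%:M : 'M[R]_(Nx * Ny) in
  let PByp := 1%:M *t (invmx (sbpP Sy) *m Bplus) : 'M[R]_(Nx * Ny) in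
  let PBym := 1%:M *t (invmx (sbpP Sy) *m Bminus) : 'M[R]_(Nx * Ny) in
  let Sg := damping sigma xg : 'M[R]_(Nx * Ny) in
  forall t : R, 0 <= t ->
  [/\ is_derive_ge0 Ez t
        (- (Dx *m Hy t) + Dy *m Hx t - Sg *m Ez t
         - alphax c *: ((1 - Rx) / 2 *: (PBxp *m Ez t)
                        - (1 + Rx) / 2 *: (PBxm *m Hy t))
         - alphay c *: ((1 - Ry) / 2 *: (PByp *m Ez t)
                        + (1 + Ry) / 2 *: (PBym *m Hx t))),
      is_derive_ge0 Hy t
        (- (Dx *m Ez t) - Sg *m Hy t
         + thetax c *: ((1 - Rx) / 2 *: (PBxm *m Ez t)
                        - (1 + Rx) / 2 *: (PBxp *m Hy t))),
      is_derive_ge0 Hx t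
        (Dy *m Ez t + Sg *m (Hx t - P t)
         - thetay c *: ((1 - Ry) / 2 *: (PBym *m Ez t)
                        + (1 + Ry) / 2 *: (PByp *m Hx t))) &
      is_derive_ge0 P t (Sg *m (Hx t - P t))].

(* The boundary terms left by the energy method applied to the undamped scheme:
   d/dt (|Ez|^2 + |Hy|^2 + |Hx|^2) = - BTs when sigma = 0. *)
Definition BTs Sx Sy (Rx Ry : R) c (Ez Hy Hx : 'cV[R]_(Nx * Ny)) : R :=
  let Px := sbpP Sx in
  let Py := sbpP Sy in
    alphax c * (1 - Rx) * bilin (Bplus *t Py) Ez Ez
  + (2 - alphax c * (1 + Rx) - thetax c * (1 - Rx)) * bilin (Bminus *t Py) Ez Hy
  + thetax c * (1 + Rx) * bilin (Bplus *t Py) Hy Hy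
  + alphay c * (1 - Ry) * bilin (Px *t Bplus) Ez Ez
  - (2 - alphay c * (1 + Ry) - thetay c * (1 - Ry)) * bilin (Px *t Bminus) Ez Hx
  + thetay c * (1 + Ry) * bilin (Px *t Bplus) Hx Hx.

Definition energy2 Sx Sy (Rx Ry : R) c
    (Ez Hy Hx P : R -> 'cV[R]_(Nx * Ny)) (t : R) : R :=
    sqnorm (Pxy Sx Sy) (Ez t) + sqnorm (Pxy Sx Sy) (Hy t)
  + sqnorm (Pxy Sx Sy) (Hx t) + sqnorm (Pxy Sx Sy) (P t)
  + \int[lebesgue_measure]_(s in `[0, t])
      BTs Sx Sy Rx Ry c (Ez s) (Hy s) (Hx s).

End pml.

(* Main.v *)
Require Import Defs.
From HB Require Import structures.
From mathcomp Require Import all_boot all_order all_algebra.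
From mathcomp Require Import all_classical all_reals all_analysis.
From mathcomp Require Import mxtens ring lra.

(** Multiply each equation by its unknown in the inner product of [Pxy] (the
    energy method).  [Pxy] cancels the inverses hidden in [sbpD] and in the
    penalties, so what is left of the derivatives are the forms of
    [sbpQ Sx *t sbpP Sy] and [sbpP Sx *t sbpQ Sy], and since [sbpQ + sbpQ^T] is
    [Bminus] these collapse to boundary terms; together with the penalties
    they are exactly [- BTs] (lemma [energy_method]).  The integral of [BTs] in
    the energy cancels them, and only the damping survives:
    writing [D u] for the form of [Pxy *m damping],
      dE/dt = 2 (D Hx - D P - D Ez - D Hy).
    The auxiliary field enters with the factor [2 (Hx + P) sigma (Hx - P)],
    whose mixed products cancel, so the only term of positive sign is
    [2 D Hx <= 2 sigma_oo |Hx|^2], which the energy dominates as soon as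
    the integral of [BTs] is nonnegative.

    The sign of [BTs] is decided node by node.  All the matrices are diagonal,
    and at a boundary node each normal direction contributes to [BTs] a positive
    weight times [a u^2 +- b u v + c v^2], the sign depending on the face.  Both
    choices of penalties make the discriminant nonpositive: with unit penalties
    [b = 0], and with the scaled ones [b^2 <= 4 a c] amounts to
    [thetabar * gamma <= 4].

    Time derivatives are relative to the half-line [0, +oo[, where the solution
    is only known to be differentiable.  They obey the usual product rule, and
    the integral of [BTs] is differentiated by extending its integrand
    to a continuous function on the whole line. *)

Set Implicit Arguments.
Unset Strict Implicit.

Import Order.TTheory GRing.Theory Num.Theory numFieldNormedType.Exports.

Local Open Scope classical_set_scope.
Local Open Scope ring_scope.

(** * Bilinear forms and Kronecker products *)

Lemma bilinE {R : realType} {n} (W : 'M[R]_n) (u v : 'cV[R]_n) :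
  bilin W u v = \sum_i \sum_j W i j * (u i 0 * v j 0).
Proof.
rewrite /bilin mxE exchange_big; apply: eq_bigr => j _ /=.
rewrite mxE big_distrl /=; apply: eq_bigr => i _.
by rewrite mxE mulrA (mulrC (W i j)).
Qed.

Lemma bilin_diag {R : realType} {n} (W : 'M[R]_n) (u v : 'cV[R]_n) :
  is_diag_mx W -> bilin W u v = \sum_i W i i * (u i 0 * v i 0).
Proof.
move=> /is_diag_mxP Wdiag; rewrite bilinE; apply: eq_bigr => i _.
rewrite (bigD1 i) //= big1 ?addr0 // => j ji.
by rewrite Wdiag ?mul0r // eq_sym.
Qed.

Lemma bilinDr {R : realType} {n} (W : 'M[R]_n) (u v w : 'cV[R]_n) :
  bilin W u (v + w) = bilin W u v + bilin W u w.
Proof. by rewrite /bilin mulmxDr mxE. Qed.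

Lemma bilinNr {R : realType} {n} (W : 'M[R]_n) (u v : 'cV[R]_n) :
  bilin W u (- v) = - bilin W u v.
Proof. by rewrite /bilin mulmxN mxE. Qed.

Lemma bilinZr {R : realType} {n} (W : 'M[R]_n) (u v : 'cV[R]_n) (a : R) :
  bilin W u (a *: v) = a * bilin W u v.
Proof. by rewrite /bilin -scalemxAr mxE. Qed.

Lemma bilin_mulr {R : realType} {n} (W M : 'M[R]_n) (u v : 'cV[R]_n) :
  bilin W u (M *m v) = bilin (W *m M) u v.
Proof. by rewrite /bilin !mulmxA. Qed.

Lemma bilin_addmx {R : realType} {n} (W M : 'M[R]_n) (u v : 'cV[R]_n) :
  bilin (W + M) u v = bilin W u v + bilin M u v.
Proof. by rewrite /bilin mulmxDr mulmxDl mxE. Qed.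

Lemma bilin_tr {R : realType} {n} (W : 'M[R]_n) (u v : 'cV[R]_n) :
  bilin W u v = bilin W^T v u.
Proof. rewrite /bilin.
have -> : (u^T *m W *m v) 0 0 = (u^T *m W *m v)^T 0 0 by rewrite [RHS]mxE.
by rewrite !trmx_mul trmxK mulmxA. Qed.

Lemma bilin_sym {R : realType} {n} (W : 'M[R]_n) (u v : 'cV[R]_n) :
  is_diag_mx W -> bilin W u v = bilin W v u.
Proof.
move=> dW; rewrite !bilin_diag //; apply: eq_bigr => i _.
by rewrite (mulrC (u i 0)).
Qed.

Lemma tensmx_diagE {R : comPzRingType} {m n} (A : 'M[R]_m) (B : 'M[R]_n) k :
  (A *t B) k k = A (mxtens_unindex k).1 (mxtens_unindex k).1
                 * B (mxtens_unindex k).2 (mxtens_unindex k).2.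
Proof. by rewrite mxE. Qed.

Lemma is_diag_tensmx {R : comPzRingType} {m n} (A : 'M[R]_m) (B : 'M[R]_n) :
  is_diag_mx A -> is_diag_mx B -> is_diag_mx (A *t B).
Proof.
move=> /is_diag_mxP dA /is_diag_mxP dB; apply/is_diag_mxP => k l.
rewrite -[k]mxtens_unindexK -[l]mxtens_unindexK.
case: (mxtens_unindex k) (mxtens_unindex l) => [i j] [i' j'] kl; rewrite tensmxE.
have [ii|ii] := eqVneq (i : nat) i'; last by rewrite dA // mul0r.
have [jj|jj] := eqVneq (j : nat) j'; last by rewrite dB // mulr0.
by move: kl; rewrite /= ii jj eqxx.
Qed.

(** * Summation by parts *)

Lemma is_diag_Bplus {R : realType} {n} : is_diag_mx (Bplus : 'M[R]_n).
Proof.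
by apply/is_diag_mxP => i j ij; rewrite !mxE -val_eqE (negbTE ij) /= addr0.
Qed.

Lemma is_diag_Bminus {R : realType} {n} : is_diag_mx (Bminus : 'M[R]_n).
Proof.
apply/is_diag_mxP => i j ij; rewrite !mxE -val_eqE (negbTE ij) /=.
by rewrite subrr.
Qed.

(** The one relation between the two boundary matrices that the sign of the
    boundary terms depends on. *)
Lemma norm_Bminus_le {R : realType} {n} (i : 'I_n) :
  `|(Bminus : 'M[R]_n) i i| <= (Bplus : 'M[R]_n) i i.
Proof.
by rewrite !mxE (le_trans (ler_normB _ _)) // !ger0_norm ?ler0n.
Qed.

(** Testing positive definiteness on the coordinate vectors. *)
Lemma sbpP_gt0 {R : realType} {n} (S : sbp_op R n) i : 0 < sbpP S i i.
Proof.
have e0 : delta_mx i 0 != 0 :> 'cV[R]_n.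
  apply/eqP => /matrixP /(_ i 0) /eqP.
  by rewrite !mxE !eqxx /= oner_eq0.
have := sbpP_posdef S e0; rewrite /sqnorm bilin_diag ?sbpP_diag //.
rewrite (bigD1 i) //= big1 ?addr0; last first.
  by move=> j ji; rewrite !mxE (negbTE ji) /= !mul0r mulr0.
by rewrite !mxE !eqxx !mulr1.
Qed.

Lemma sbpP_unit {R : realType} {n} (S : sbp_op R n) : sbpP S \in unitmx.
Proof.
rewrite unitmxE unitfE det_trig; last exact/is_diag_mx_is_trig/sbpP_diag.
by apply/prodf_neq0 => i _; rewrite gt_eqF ?sbpP_gt0.
Qed.

Lemma sbpPVK {R : realType} {n} (S : sbp_op R n) (M : 'M[R]_n) :
  sbpP S *m (invmx (sbpP S) *m M) = M.
Proof. by rewrite mulmxA mulmxV ?sbpP_unit ?mul1mx. Qed.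

Lemma sbpP_tr {R : realType} {n} (S : sbp_op R n) : (sbpP S)^T = sbpP S.
Proof.
apply/matrixP => i j; rewrite mxE.
have [->//|ij] := eqVneq i j.
by move/is_diag_mxP: (sbpP_diag S) => dP; rewrite !dP // eq_sym.
Qed.

Lemma tensmxDl {R : pzRingType} {m n p q} (A A' : 'M[R]_(m, n)) (B : 'M[R]_(p, q)) :
  (A + A') *t B = A *t B + A' *t B.
Proof. by apply/matrixP => k l; rewrite !mxE mulrDl. Qed.

Lemma tensmxDr {R : pzRingType} {m n p q} (A : 'M[R]_(m, n)) (B B' : 'M[R]_(p, q)) :
  A *t (B + B') = A *t B + A *t B'.
Proof. by apply/matrixP => k l; rewrite !mxE mulrDr. Qed.

(** The discrete counterpart of integrating [d/dx (u v)]: by symmetry of the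
    weights in [y], exchanging [u] and [v] transposes [sbpQ Sx] alone. *)
Lemma summation_by_parts_x {R : realType} {Nx Ny} (Sx : sbp_op R Nx)
    (Sy : sbp_op R Ny) u v :
  bilin (sbpQ Sx *t sbpP Sy) u v + bilin (sbpQ Sx *t sbpP Sy) v u
  = bilin (Bminus *t sbpP Sy) u v.
Proof.
rewrite (bilin_tr _ v u) trmx_tens sbpP_tr -bilin_addmx.
by rewrite -tensmxDl sbpQ_byparts.
Qed.

Lemma summation_by_parts_y {R : realType} {Nx Ny} (Sx : sbp_op R Nx)
    (Sy : sbp_op R Ny) u v :
  bilin (sbpP Sx *t sbpQ Sy) u v + bilin (sbpP Sx *t sbpQ Sy) v u
  = bilin (sbpP Sx *t Bminus) u v.
Proof.
rewrite (bilin_tr _ v u) trmx_tens sbpP_tr -bilin_addmx.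
by rewrite -tensmxDr sbpQ_byparts.
Qed.

(** * Sign of the boundary terms *)

Lemma quadratic_ge0 {R : realFieldType} (a b c x y : R) :
  0 <= a -> 0 <= c -> b ^+ 2 <= 4 * a * c ->
  0 <= a * x ^+ 2 + b * (x * y) + c * y ^+ 2.
Proof.
move=> a0 c0 disc.
have [a_eq0|a_neq0] := eqVneq a 0.
  have b_eq0 : b = 0.
    apply/eqP; rewrite -sqrf_eq0 eq_le sqr_ge0 andbT.
    by rewrite (le_trans disc) // a_eq0 mulr0 mul0r.
  by rewrite a_eq0 b_eq0 !mul0r !add0r mulr_ge0 ?sqr_ge0.
(* complete the square, after multiplying by 4 a *)
have a_gt0 : 0 < a by rewrite lt_def a_neq0.
rewrite -(pmulr_rge0 _ (_ : 0 < 4 * a)); last by rewrite mulr_gt0.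
have -> : 4 * a * (a * x ^+ 2 + b * (x * y) + c * y ^+ 2) =
          (2 * a * x + b * y) ^+ 2 + (4 * a * c - b ^+ 2) * y ^+ 2 by ring.
by rewrite addr_ge0 ?sqr_ge0 // mulr_ge0 ?sqr_ge0 // subr_ge0.
Qed.

(** At node [k] the form is quadratic in [(u k, v k)] with coefficients
    [a Mp], [b Mm], [c Mp], and [`|Mm| <= Mp] keeps the discriminant nonpositive. *)
Lemma boundary_form_ge0 {R : realType} {n} (Mp Mm : 'M[R]_n) (a b c : R)
    (u v : 'cV[R]_n) :
  is_diag_mx Mp -> is_diag_mx Mm -> (forall k, `|Mm k k| <= Mp k k) ->
  0 <= a -> 0 <= c -> b ^+ 2 <= 4 * a * c ->
  0 <= a * bilin Mp u u + b * bilin Mm u v + c * bilin Mp v v.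
Proof.
move=> dMp dMm MmMp a0 c0 disc; rewrite !bilin_diag // !big_distrr /= -!big_split /=.
apply: sumr_ge0 => k _.
have -> : a * (Mp k k * (u k 0 * u k 0)) + b * (Mm k k * (u k 0 * v k 0)) +
    c * (Mp k k * (v k 0 * v k 0)) =
    a * Mp k k * u k 0 ^+ 2 + b * Mm k k * (u k 0 * v k 0) + c * Mp k k * v k 0 ^+ 2.
  by ring.
have Mp0 : 0 <= Mp k k by rewrite (le_trans _ (MmMp k)).
apply: quadratic_ge0; rewrite ?mulr_ge0 // exprMn.
have -> : 4 * (a * Mp k k) * (c * Mp k k) = (4 * a * c) * Mp k k ^+ 2 by ring.
apply: ler_pM; rewrite ?sqr_ge0 //.
by rewrite -(real_normK (num_real (Mm k k))) lerXn2r ?nnegrE.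
Qed.

Lemma face_form_x_ge0 {R : realType} {Nx Ny} (Sy : sbp_op R Ny) (a b c : R)
  (u v : 'cV[R]_(Nx * Ny)) :
  0 <= a -> 0 <= c -> b ^+ 2 <= 4 * a * c ->
  0 <= a * bilin (Bplus *t sbpP Sy) u u + b * bilin (Bminus *t sbpP Sy) u v
     + c * bilin (Bplus *t sbpP Sy) v v.
Proof.
apply: boundary_form_ge0.
- exact: is_diag_tensmx is_diag_Bplus (sbpP_diag Sy).
- exact: is_diag_tensmx is_diag_Bminus (sbpP_diag Sy).
- move=> k; rewrite !tensmx_diagE normrM (gtr0_norm (sbpP_gt0 _ _)).
  by rewrite ler_wpM2r ?norm_Bminus_le // ltW ?sbpP_gt0.
Qed.

Lemma face_form_y_ge0 {R : realType} {Nx Ny} (Sx : sbp_op R Nx) (a b c : R)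
  (u v : 'cV[R]_(Nx * Ny)) :
  0 <= a -> 0 <= c -> b ^+ 2 <= 4 * a * c ->
  0 <= a * bilin (sbpP Sx *t Bplus) u u + b * bilin (sbpP Sx *t Bminus) u v
     + c * bilin (sbpP Sx *t Bplus) v v.
Proof.
apply: boundary_form_ge0.
- exact: is_diag_tensmx (sbpP_diag Sx) is_diag_Bplus.
- exact: is_diag_tensmx (sbpP_diag Sx) is_diag_Bminus.
- move=> k; rewrite !tensmx_diagE normrM (gtr0_norm (sbpP_gt0 _ _)).
  by rewrite ler_wpM2l ?norm_Bminus_le // ltW ?sbpP_gt0.
Qed.

(** The conditions under which the terms of [BTs] attached to one coordinate
    direction are nonnegative, for arbitrary values of the unknowns: the
    coefficients [a], [c] of the squares are nonnegative and the coefficient [b]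
    of the mixed product satisfies [b^2 <= 4 a c]. *)
Definition penalty_admissible {R : realType} (r alpha theta : R) :=
  [/\ 0 <= alpha * (1 - r), 0 <= theta * (1 + r) &
      (2 - alpha * (1 + r) - theta * (1 - r)) ^+ 2
        <= 4 * (alpha * (1 - r)) * (theta * (1 + r))].

(** The mixed product disappears: [2 - (1 + r) - (1 - r) = 0]. *)
Lemma penalty_admissible_one {R : realType} (r : R) :
  `|r| <= 1 -> penalty_admissible r 1 1.
Proof.
rewrite ler_norml => /andP[r1 r2]; split; rewrite ?mul1r; [lra|lra|].
have -> : 2 - (1 + r) - (1 - r) = 0 by ring.
by rewrite expr0n /= !mulr_ge0; lra.
Qed.

(** The coefficients are [2 gamma], [- 2 tb gamma] and [2 tb], so that
    [4 a c - b^2 = 4 (tb gamma) (4 - tb gamma)]; this is where the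
    bound [4 / gamma] comes from. *)
Lemma penalty_admissible_scaled {R : realType} (r tb : R) :
  `|r| <= 1 -> r != -1 -> admissible_thetabar r tb ->
  penalty_admissible r (2 / (1 + r)) (2 * tb / (1 + r)).
Proof.
rewrite ler_norml => /andP[r1 r2] rN1 [tb0 tb_le].
have r_gt0 : 0 < 1 + r by rewrite addrC -ltrBlDr sub0r lt_def rN1.
have r_neq0 : 1 + r != 0 by rewrite gt_eqF.
have g0 : 0 <= refl_gamma r by rewrite divr_ge0 ?subr_ge0 // ltW.
rewrite /penalty_admissible.
have -> : 2 / (1 + r) * (1 - r) = 2 * refl_gamma r by rewrite /refl_gamma; field.
have -> : 2 * tb / (1 + r) * (1 + r) = 2 * tb by field.
have -> : 2 / (1 + r) * (1 + r) = 2 by field.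
have -> : 2 * tb / (1 + r) * (1 - r) = 2 * tb * refl_gamma r.
  by rewrite /refl_gamma; field.
split; [by rewrite mulr_ge0|by rewrite mulr_ge0|].
have tbg : tb * refl_gamma r <= 4.
  have [->|g_neq0] := eqVneq (refl_gamma r) 0; first by rewrite mulr0.
  by rewrite -ler_pdivlMr ?tb_le // lt_def g_neq0.
rewrite -subr_ge0.
have -> : 4 * (2 * refl_gamma r) * (2 * tb) - (2 - 2 - 2 * tb * refl_gamma r) ^+ 2
   = 4 * (tb * refl_gamma r) * (4 - tb * refl_gamma r) by ring.
apply: mulr_ge0; last by rewrite subr_ge0.
by rewrite mulr_ge0 // mulr_ge0.
Qed.

Lemma penalties_admissible {R : realType} (Rx Ry : R) (c : penalties R) :
  `|Rx| <= 1 -> `|Ry| <= 1 -> penalties_i Rx Ry c \/ penalties_ii Rx Ry c ->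
  penalty_admissible Rx (alphax c) (thetax c) /\
  penalty_admissible Ry (alphay c) (thetay c).
Proof.
move=> hRx hRy [[Rx1 Ry1 -> -> [tbx [tby [-> -> tbxP tbyP]]]]|[_ _ -> -> [-> ->]]].
  by split; exact: penalty_admissible_scaled.
by split; exact: penalty_admissible_one.
Qed.

Lemma BTs_ge0 {R : realType} {Nx Ny} (Sx : sbp_op R Nx) (Sy : sbp_op R Ny)
    (Rx Ry : R) (c : penalties R) (u v w : 'cV[R]_(Nx * Ny)) :
  penalty_admissible Rx (alphax c) (thetax c) ->
  penalty_admissible Ry (alphay c) (thetay c) ->
  0 <= BTs Sx Sy Rx Ry c u v w.
Proof.
move=> [ax tx dx] [ay ty dy].
have px := face_form_x_ge0 Sy u v ax tx dx.
(* the mixed product enters with opposite signs in the two directions *)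
have := face_form_y_ge0 Sx u w ay ty.
move=> /(_ (- (2 - alphay c * (1 + Ry) - thetay c * (1 - Ry)))).
rewrite sqrrN => /(_ dy) py.
rewrite /BTs; lra.
Qed.

(** * The energy method *)

Section energy_rate.
Context {R : realType} {Nx Ny : nat}.
Context (Sx : sbp_op R Nx) (Sy : sbp_op R Ny).
Context (sigma : R -> R) (xg : 'I_Nx -> R) (Rx Ry : R) (c : penalties R).

Notation Dx := (sbpD Sx *t 1%:M : 'M[R]_(Nx * Ny)).
Notation Dy := (1%:M *t sbpD Sy : 'M[R]_(Nx * Ny)).
Notation PBxp := ((invmx (sbpP Sx) *m Bplus) *t 1%:M : 'M[R]_(Nx * Ny)).
Notation PBxm := ((invmx (sbpP Sx) *m Bminus) *t 1%:M : 'M[R]_(Nx * Ny)).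
Notation PByp := (1%:M *t (invmx (sbpP Sy) *m Bplus) : 'M[R]_(Nx * Ny)).
Notation PBym := (1%:M *t (invmx (sbpP Sy) *m Bminus) : 'M[R]_(Nx * Ny)).
Notation Sg := (damping sigma xg : 'M[R]_(Nx * Ny)).
Notation W := (Pxy Sx Sy).
Implicit Types u v w p : 'cV[R]_(Nx * Ny).

(** The energy balance is algebraic in the values of the unknowns at one instant,
    so the right-hand sides are taken here as functions of those values and not
    of time. *)
Definition Ez_rate u v w :=
  - (Dx *m v) + Dy *m w - Sg *m u
  - alphax c *: ((1 - Rx) / 2 *: (PBxp *m u) - (1 + Rx) / 2 *: (PBxm *m v))
  - alphay c *: ((1 - Ry) / 2 *: (PByp *m u) + (1 + Ry) / 2 *: (PBym *m w)).

Definition Hy_rate u v :=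
  - (Dx *m u) - Sg *m v
  + thetax c *: ((1 - Rx) / 2 *: (PBxm *m u) - (1 + Rx) / 2 *: (PBxp *m v)).

Definition Hx_rate u w p :=
  Dy *m u + Sg *m (w - p)
  - thetay c *: ((1 - Ry) / 2 *: (PBym *m u) + (1 + Ry) / 2 *: (PByp *m w)).

Definition P_rate w p := Sg *m (w - p).

(** The weight cancels the inverse in the derivative and penalty
    operators alike. *)
Lemma Pxy_mul_x (M : 'M[R]_Nx) :
  W *m ((invmx (sbpP Sx) *m M) *t 1%:M) = M *t sbpP Sy.
Proof. by rewrite tensmx_mul mulmx1 sbpPVK. Qed.

Lemma Pxy_mul_y (M : 'M[R]_Ny) :
  W *m (1%:M *t (invmx (sbpP Sy) *m M)) = sbpP Sx *t M.
Proof. by rewrite tensmx_mul mulmx1 sbpPVK. Qed.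

Lemma is_diag_Pxy : is_diag_mx W.
Proof. exact: is_diag_tensmx (sbpP_diag _) (sbpP_diag _). Qed.

Lemma is_diag_damping : is_diag_mx (W *m Sg).
Proof.
rewrite tensmx_mul mulmx1; apply: is_diag_tensmx; last exact: sbpP_diag.
rewrite mul_mx_diag; apply/is_diag_mxP => i j ij; rewrite mxE.
by move/is_diag_mxP: (sbpP_diag Sx) => ->//; rewrite mul0r.
Qed.

Lemma damping_diagE k :
  (W *m Sg) k k = W k k * sigma (xg (mxtens_unindex k).1).
Proof.
rewrite tensmx_mul mulmx1 !tensmx_diagE mul_mx_diag !mxE.
by rewrite mulrAC.
Qed.

Lemma Pxy_gt0 k : 0 < W k k.
Proof. by rewrite tensmx_diagE mulr_gt0 ?sbpP_gt0. Qed.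

Lemma sqnorm_Pxy_ge0 u : 0 <= sqnorm W u.
Proof.
rewrite /sqnorm bilin_diag ?is_diag_Pxy //; apply: sumr_ge0 => k _.
by rewrite mulr_ge0 ?(ltW (Pxy_gt0 k)) // -expr2 sqr_ge0.
Qed.

Lemma damping_form_ge0 u : (forall i, 0 <= sigma (xg i)) -> 0 <= bilin (W *m Sg) u u.
Proof.
move=> sg0; rewrite bilin_diag ?is_diag_damping //; apply: sumr_ge0 => k _.
rewrite damping_diagE; apply: mulr_ge0; last by rewrite -expr2 sqr_ge0.
by rewrite mulr_ge0 // ltW // Pxy_gt0.
Qed.

Lemma damping_form_le u m : (forall i, sigma (xg i) <= m) ->
  bilin (W *m Sg) u u <= m * sqnorm W u.
Proof.
move=> sgm; rewrite /sqnorm !bilin_diag ?is_diag_damping ?is_diag_Pxy //.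
rewrite big_distrr /=; apply: ler_sum => k _.
rewrite damping_diagE [leRHS]mulrCA -mulrA ler_wpM2l ?(ltW (Pxy_gt0 k)) //.
by rewrite ler_wpM2r // -expr2 sqr_ge0.
Qed.

(** The whole energy balance, apart from the time integral.  Both mixed products
    of the damping of [w] and [p] occur, with opposite signs. *)
Lemma energy_method u v w p :
  2 * (bilin W u (Ez_rate u v w) + bilin W v (Hy_rate u v)
       + bilin W w (Hx_rate u w p) + bilin W p (P_rate w p))
  = - BTs Sx Sy Rx Ry c u v w
    + 2 * (bilin (W *m Sg) w w - bilin (W *m Sg) p p
           - bilin (W *m Sg) u u - bilin (W *m Sg) v v).
Proof.
rewrite /Ez_rate /Hy_rate /Hx_rate /P_rate.
rewrite !(bilinDr, bilinNr, bilinZr, bilin_mulr) /sbpD !Pxy_mul_x !Pxy_mul_y.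
have sx := summation_by_parts_x Sx Sy u v.
have sy := summation_by_parts_y Sx Sy u w.
have bx : bilin (Bminus *t sbpP Sy) v u = bilin (Bminus *t sbpP Sy) u v.
  by apply: bilin_sym; exact: is_diag_tensmx is_diag_Bminus (sbpP_diag _).
have by_ : bilin (sbpP Sx *t Bminus) w u = bilin (sbpP Sx *t Bminus) u w.
  by apply: bilin_sym; exact: is_diag_tensmx (sbpP_diag _) is_diag_Bminus.
have bs : bilin (W *m Sg) w p = bilin (W *m Sg) p w.
  by apply: bilin_sym; exact: is_diag_damping.
rewrite /BTs bx by_ bs -sx -sy.
by field.
Qed.

End energy_rate.

(** * Derivatives relative to the half-line *)

Section half_line_calculus.
Context {R : realType}.
Implicit Types (f g : R -> R^o) (t : R).

Notation halfline := [set s : R | 0 <= s].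

(** [f s] is [f t] plus [s - t] times the difference quotient, which has a limit. *)
Lemma is_derive_ge0_cvg f t (df : R) : is_derive_ge0 f t df ->
  f s @[s --> within halfline t^'] --> f t.
Proof.
move=> fdf.
have st : s - t @[s --> within halfline t^'] --> (0 : R).
  rewrite -(subrr t); apply: cvgB; last exact: cvg_cst.
  by move=> A /nbhs_dnbhs tA; apply: cvg_within.
have : f t + (s - t) * ((s - t)^-1 *: (f s - f t))
  @[s --> within halfline t^'] --> f t + 0 * df.
  by apply: cvgD; [exact: cvg_cst|exact: cvgM].
rewrite mul0r addr0; apply: cvg_trans; apply: near_eq_cvg; rewrite near_withinE.
near=> s => _; have st0 : s - t != 0.
  by rewrite subr_eq0; near: s; exact: nbhs_dnbhs_neq.
by rewrite /GRing.scale /= mulVKf // addrC subrK.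
Unshelve. all: by end_near. Qed.

Lemma is_derive_ge0_continuous f t (df : R) : is_derive_ge0 f t df ->
  f s @[s --> within halfline (nbhs t)] --> f t.
Proof.
move=> /is_derive_ge0_cvg fct A Af.
have fA : nbhs t (fun s => s != t -> 0 <= s -> A (f s)) := fct _ Af.
apply: filterS fA => s sA s0.
by have [->|st] := eqVneq s t; [exact: nbhs_singleton Af|exact: sA].
Qed.

Lemma is_derive_ge0_cst (a : R) t : is_derive_ge0 (fun=> a : R^o) t 0.
Proof.
rewrite /is_derive_ge0; under eq_fun do rewrite subrr scaler0.
exact: cvg_cst.
Qed.

Lemma is_derive_ge0D f g t (df dg : R) :
  is_derive_ge0 f t df -> is_derive_ge0 g t dg ->
  is_derive_ge0 (fun s => f s + g s : R^o) t (df + dg).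
Proof.
move=> fdf gdg; rewrite /is_derive_ge0.
under eq_fun do rewrite opprD addrACA scalerDr.
exact: cvgD.
Qed.

Lemma is_derive_ge0M f g t (df dg : R) :
  is_derive_ge0 f t df -> is_derive_ge0 g t dg ->
  is_derive_ge0 (fun s => f s * g s : R^o) t (df * g t + f t * dg).
Proof.
move=> fdf gdg; rewrite /is_derive_ge0.
have gt := is_derive_ge0_cvg gdg.
have E s : (s - t)^-1 *: (f s * g s - f t * g t) =
  (s - t)^-1 *: (f s - f t) * g s + f t * ((s - t)^-1 *: (g s - g t)).
  by rewrite /GRing.scale /=; ring.
under eq_fun do rewrite E.
by apply: cvgD; apply: cvgM => //; exact: cvg_cst.
Qed.

Lemma is_derive_ge0_sum (I : finType) (F : I -> R -> R^o) (dF : I -> R) t :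
  (forall i, is_derive_ge0 (F i) t (dF i)) ->
  is_derive_ge0 (fun s => \sum_i F i s : R^o) t (\sum_i dF i).
Proof.
move=> FdF; rewrite /is_derive_ge0.
under eq_fun do rewrite -sumrB scaler_sumr.
by apply: cvg_big => [|i _]; [exact: add_continuous|exact: FdF].
Qed.

Lemma is_derive_ge0_coord {n} (f : R -> 'cV[R]_n) t (df : 'cV[R]_n) i :
  is_derive_ge0 f t df -> is_derive_ge0 (fun s => f s i 0 : R^o) t (df i 0).
Proof.
move=> fdf; rewrite /is_derive_ge0.
have := cvg_comp _ _ fdf (@coord_continuous R n 1 i 0 df).
by apply: cvg_trans; apply: near_eq_cvg; apply: nearW => s /=; rewrite !mxE.
Qed.

Lemma is_derive_ge0_bilin {n} (W : 'M[R]_n) (f g : R -> 'cV[R]_n) t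
    (df dg : 'cV[R]_n) :
  is_derive_ge0 f t df -> is_derive_ge0 g t dg ->
  is_derive_ge0 (fun s => bilin W (f s) (g s) : R^o) t
    (bilin W df (g t) + bilin W (f t) dg).
Proof.
move=> fdf gdg.
under [X in is_derive_ge0 X]eq_fun do rewrite bilinE.
rewrite !bilinE -big_split /=; apply: is_derive_ge0_sum => i.
rewrite -big_split /=; apply: is_derive_ge0_sum => j.
rewrite -mulrDr -[X in is_derive_ge0 _ _ X]add0r -{1}(mul0r (f t i 0 * g t j 0)).
apply: is_derive_ge0M; first exact: is_derive_ge0_cst.
by apply: is_derive_ge0M; exact: is_derive_ge0_coord.
Qed.

(** The fundamental theorem of calculus for an integrand that is continuous on
    the half-line only.  The extension [g] of [b] by the constant [b 0] is
    continuous everywhere, so its primitive from [-1] has a two-sided derivative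
    even at [0], and on the half-line the two primitives differ by a constant. *)
Lemma is_derive_ge0_integral (b : R -> R) t : 0 <= t ->
  (forall s : R, 0 <= s -> b r @[r --> within halfline (nbhs s)] --> b s) ->
  is_derive_ge0 (fun s => \int[lebesgue_measure]_(r in `[0, s]) b r : R^o) t (b t).
Proof.
move=> t0 bc.
pose g (s : R) := b (Num.max s 0).
have gb (s : R) : 0 <= s -> g s = b s by move=> s0; rewrite /g max_l.
have gc : continuous g.
  move=> s A gA.
  have m0 (r : R) : 0 <= Num.max r 0 by rewrite le_max lexx orbT.
  have bA : nbhs (Num.max s 0) (fun r => 0 <= r -> A (b r)) := bc _ (m0 s) A gA.
  have mc : {for s, continuous (fun r : R => Num.max r 0)}.
    by apply: continuous_max; [exact: cvg_id|exact: cvg_cst].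
  have mA : nbhs s (fun r => 0 <= Num.max r 0 -> A (b (Num.max r 0))) := mc _ bA.
  by apply: filterS mA => r; apply; exact: m0.
have gi (a c : R) : lebesgue_measure.-integrable `[a, c] (EFin \o g).
  apply: continuous_compact_integrable; first exact: segment_compact.
  by apply: continuous_subspaceT => x; exact: gc.
pose F (s : R) := \int[lebesgue_measure]_(r in `[-1, s]) g r.
have tt1 : t < t + 1 by rewrite ltrDl.
have t1 : -1 < t by rewrite (lt_le_trans _ t0).
have [dF F't] := continuous_FTC1_closed tt1 (gi (-1) (t + 1)) t1 (gc t).
have Fb : (s - t)^-1 *: (F s - F t) @[s --> t^'] --> (b t : R^o).
  have st : (s - t) @[s --> t^'] --> (0 : R)^'.
    rewrite -[X in _ --> X^'](subrr t); apply: continuous_injective_withinNx.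
      by apply: cvgB; [exact: cvg_id|exact: cvg_cst].
    by move=> s /addIr.
  have dFt : h^-1 *: (F (h *: 1 + t) - F t) @[h --> 0^'] --> (b t : R^o).
    by rewrite -(gb t t0) -F't derive1E; exact: dF.
  have := cvg_comp _ _ st dFt.
  apply: cvg_trans; apply: near_eq_cvg; apply: nearW => s /=.
  by rewrite /GRing.scale /= mulr1 subrK.
have EF (s : R) : 0 <= s -> \int[lebesgue_measure]_(r in `[0, s]) b r = F s - F 0.
  move=> s0.
  rewrite /F Rintegral_itvB ?bnd_simp //.
  rewrite Rintegral_itv_obnd_cbnd; last first.
    by apply: integrableS (gi 0 s) => //; apply: subset_itv_oc_cc.
  apply: eq_Rintegral => r; rewrite inE /= in_itv /= => /andP[r0 _].
  by rewrite gb.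
rewrite /is_derive_ge0.
have : (s - t)^-1 *: (F s - F t) @[s --> within halfline t^'] --> (b t : R^o).
  exact: cvg_trans (cvg_app _ (cvg_within _)) Fb.
apply: cvg_trans; apply: near_eq_cvg; rewrite near_withinE; near=> s => s0.
by rewrite !EF // opprB addrA subrK.
Unshelve. all: by end_near. Qed.

End half_line_calculus.

(** * Evolution of the energy *)

Lemma is_derive_ge0_sqnorm {R : realType} {n} (W : 'M[R]_n) (f : R -> 'cV[R]_n)
    t (df : 'cV[R]_n) :
  is_diag_mx W -> is_derive_ge0 f t df ->
  is_derive_ge0 (fun s => sqnorm W (f s) : R^o) t (2 * bilin W (f t) df).
Proof.
move=> dW fdf; rewrite mulrDl mul1r {1}(bilin_sym _ _ dW).
exact: is_derive_ge0_bilin.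
Qed.

Lemma BTs_continuous {R : realType} {Nx Ny} (Sx : sbp_op R Nx) (Sy : sbp_op R Ny)
    (Rx Ry : R) (c : penalties R) (u v w : R -> 'cV[R]_(Nx * Ny)) (t : R)
    (du dv dw : 'cV[R]_(Nx * Ny)) :
  is_derive_ge0 u t du -> is_derive_ge0 v t dv -> is_derive_ge0 w t dw ->
  BTs Sx Sy Rx Ry c (u s) (v s) (w s) @[s --> within [set s : R | 0 <= s] (nbhs t)]
    --> BTs Sx Sy Rx Ry c (u t) (v t) (w t).
Proof.
move=> du' dv' dw'.
have scaled_cvg (a : R) (W : 'M[R]_(Nx * Ny)) f g df dg :
    is_derive_ge0 f t df -> is_derive_ge0 g t dg ->
    a * bilin W (f s) (g s) @[s --> within [set s : R | 0 <= s] (nbhs t)]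
      --> a * bilin W (f t) (g t).
  move=> fdf gdg; apply: cvgM; first exact: cvg_cst.
  exact: is_derive_ge0_continuous (@is_derive_ge0_bilin R _ W f g t df dg fdf gdg).
apply: cvgD; last exact: (scaled_cvg _ _ _ _ _ _ dw' dw').
apply: cvgB; last exact: (scaled_cvg _ _ _ _ _ _ du' dw').
apply: cvgD; last exact: (scaled_cvg _ _ _ _ _ _ du' du').
apply: cvgD; last exact: (scaled_cvg _ _ _ _ _ _ dv' dv').
apply: cvgD; first exact: (scaled_cvg _ _ _ _ _ _ du' du').
exact: (scaled_cvg _ _ _ _ _ _ du' dv').
Qed.

(** The derivative of the integral is [BTs] at time [t], which cancels the boundary
    terms of [energy_method]. *)
Lemma energy2_rate {R : realType} {Nx Ny} (Sx : sbp_op R Nx) (Sy : sbp_op R Ny)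
    (sigma : R -> R) (xg : 'I_Nx -> R) (Rx Ry : R) (c : penalties R)
    (Ez Hy Hx P : R -> 'cV[R]_(Nx * Ny)) (t : R) :
  pml_solution Sx Sy sigma xg Rx Ry c Ez Hy Hx P -> 0 <= t ->
  let D u := bilin (Pxy Sx Sy *m damping sigma xg) u u in
  is_derive_ge0 (energy2 Sx Sy Rx Ry c Ez Hy Hx P : R -> R^o) t
    (2 * (D (Hx t) - D (P t) - D (Ez t) - D (Hy t))).
Proof.
move=> sol t0 D.
have [dEz dHy dHx dP] := sol t t0.
have dW := is_diag_Pxy Sx Sy.
have dI : is_derive_ge0 (fun s => \int[lebesgue_measure]_(r in `[0, s])
    BTs Sx Sy Rx Ry c (Ez r) (Hy r) (Hx r) : R^o) t
    (BTs Sx Sy Rx Ry c (Ez t) (Hy t) (Hx t)).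
  apply: is_derive_ge0_integral => // s s0.
  have [dEs dHys dHxs _] := sol s s0.
  exact: BTs_continuous dEs dHys dHxs.
have := is_derive_ge0D (is_derive_ge0D (is_derive_ge0D (is_derive_ge0D
  (is_derive_ge0_sqnorm dW dEz) (is_derive_ge0_sqnorm dW dHy))
  (is_derive_ge0_sqnorm dW dHx)) (is_derive_ge0_sqnorm dW dP)) dI.
congr (is_derive_ge0 _ _ _).
have := energy_method Sx Sy sigma xg Rx Ry c (Ez t) (Hy t) (Hx t) (P t).
rewrite /Ez_rate /Hy_rate /Hx_rate /P_rate -/(D _) => em.
by rewrite -!mulrDr em addrAC addNr add0r.
Qed.

Unset Implicit Arguments.

Theorem theorem5p3 (R : realType) (Nx Ny : nat)
  (hNx : (2 <= Nx)%N) (hNy : (2 <= Ny)%N)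
  (Sx : sbp_op R Nx) (Sy : sbp_op R Ny)
  (Omega : set R) (xg : 'I_Nx -> R) (hxg : forall i, Omega (xg i))
  (sigma : R -> R) (hsigma : forall x, Omega x -> 0 <= sigma x)
  (sigma_oo : R) (hsigma_oo : is_max_of (sigma @` Omega) sigma_oo)
  (Rx Ry : R) (hRx : `|Rx| <= 1) (hRy : `|Ry| <= 1)
  (c : penalties R) (hc : penalties_i Rx Ry c \/ penalties_ii Rx Ry c)
  (Ez Hy Hx P : R -> 'cV[R]_(Nx * Ny))
  (hsol : pml_solution Sx Sy sigma xg Rx Ry c Ez Hy Hx P) :
  forall t : R, 0 <= t ->
  [/\ 0 <= BTs Sx Sy Rx Ry c (Ez t) (Hy t) (Hx t),
      0 <= energy2 Sx Sy Rx Ry c Ez Hy Hx P t &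
      exists2 dE : R,
        is_derive_ge0 (energy2 Sx Sy Rx Ry c Ez Hy Hx P : R -> R^o) t dE &
        dE <= 2 * sigma_oo * energy2 Sx Sy Rx Ry c Ez Hy Hx P t].

Proof.
have sigma_le i : sigma (xg i) <= sigma_oo.
  by apply: hsigma_oo.2; exists (xg i) => //; exact: hxg.
have sigma_ge0 i : 0 <= sigma (xg i) by exact/hsigma/hxg.
have sigma_oo_ge0 : 0 <= sigma_oo by have [[x Ox <-] _] := hsigma_oo; exact: hsigma.
have [adx ady] := penalties_admissible hRx hRy hc.
have BT0 s : 0 <= BTs Sx Sy Rx Ry c (Ez s) (Hy s) (Hx s) by exact: BTs_ge0.
move=> t t0.
have int0 : 0 <= \int[lebesgue_measure]_(s in `[0, t])
    BTs Sx Sy Rx Ry c (Ez s) (Hy s) (Hx s).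
  by apply: Rintegral_ge0 => s _; exact: BT0.
have norm0 u : 0 <= sqnorm (Pxy Sx Sy) u by exact: sqnorm_Pxy_ge0.
split; first exact: BT0.
  by rewrite /energy2 !addr_ge0.
eexists; first exact: energy2_rate hsol t0.
have D0 u := damping_form_ge0 Sx Sy u sigma_ge0.
rewrite -mulrA ler_pM2l //.
apply: (@le_trans _ _ (sigma_oo * sqnorm (Pxy Sx Sy) (Hx t))).
  have := damping_form_le Sx Sy (Hx t) sigma_le.
  have := D0 (P t); have := D0 (Ez t); have := D0 (Hy t).
  by lra.
(* |Hx|^2 is one of five nonnegative summands of the energy *)
apply: ler_wpM2l => //; rewrite /energy2.
have := norm0 (Ez t); have := norm0 (Hy t); have := norm0 (P t).
by lra.
Qed.
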